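(* The group $W_3(\mathbb Z)=\mathbb Z\wr(\mathbb Z\wr\mathbb Z)$ is isomorphic to a subgroup of $\mathcal F_2$, the group of finite-state automorphisms of the binary rooted tree. Consequently $\mathbb Z\wr(\mathbb Z\wr\mathbb Z)$ is a subgroup of an automata group acting on the binary tree.
   Context: Wreath products are restricted wreath products with the regular action. For $m\ge2$, $\mathcal T_m$ is the one-rooted $m$-regular tree with vertices the finite words over $\{1,\dots,m\}$, $\mathcal A_m$ its automorphism group, each $\alpha\in\mathcal A_m$ written $\alpha=(\alpha_1,\dots,\alpha_m)\sigma(\alpha)$ with $\sigma(\alpha)\in S_m$ the first-level action and $\alpha_i$ the states; $Q(\alpha)=\{\alpha\}\cup\bigcup_iQ(\alpha_i)$, $\alpha$ is finite-state if $Q(\alpha)$ is finite, and $\mathcal F_m$ is the group of finite-state automorphisms. A subgroup $G\le\mathcal A_m$ is self-similar if $Q(\alpha)\subseteq G$ for all $\alpha\in G$; an automata group is a finitely generated self-similar subgroup of some $\mathcal F_m$. *)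

(* Defs.v *)
From HB Require Import structures.
From mathcomp Require Import all_boot all_order all_algebra.
From mathcomp Require Import finmap.
From Stdlib Require List.

Set Implicit Arguments.
Unset Strict Implicit.
Unset Printing Implicit Defensive.

Import Order.TTheory GRing.Theory Num.Theory.
Local Open Scope fset_scope.

(* Restricted wreath product  Z wr B  with the regular (left) action of B. *)
Section Wreath.
Variables (T : choiceType) (mulT : T -> T -> T) (invT : T -> T) (oneT : T).

Definition wbase := {fsfun T -> int for fun _ => 0%R}.
Definition wr := (wbase * T)%type.

Definition wbase0 : wbase := [fsfun x in fset0 => 0%R | 0%R].
Definition wbase_add (f g : wbase) : wbase :=
  [fsfun x in finsupp f `|` finsupp g => (f x + g x)%R | 0%R].
Definition wbase_opp (f : wbase) : wbase :=
  [fsfun x in finsupp f => (- f x)%R | 0%R].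
Definition wshift (b : T) (g : wbase) : wbase :=
  [fsfun x in [fset mulT b y | y in finsupp g] => g (mulT (invT b) x) | 0%R].

Definition wr_mul (u v : wr) : wr :=
  (wbase_add u.1 (wshift u.2 v.1), mulT u.2 v.2).
Definition wr_inv (u : wr) : wr :=
  (wbase_opp (wshift (invT u.2) u.1), invT u.2).
Definition wr_one : wr := (wbase0, oneT).
End Wreath.

Definition W2 : choiceType := wr int.
Definition W2_mul : W2 -> W2 -> W2 := @wr_mul int (fun a b => a + b)%R (fun a => - a)%R.
Definition W2_inv : W2 -> W2 := @wr_inv int (fun a b => a + b)%R (fun a => - a)%R.
Definition W2_one : W2 := @wr_one int 0%R.

Definition W3 : choiceType := wr W2.
Definition W3_mul : W3 -> W3 -> W3 := @wr_mul W2 W2_mul W2_inv.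
Definition W3_inv : W3 -> W3 := @wr_inv W2 W2_mul W2_inv.
Definition W3_one : W3 := @wr_one W2 W2_one.

(* The binary rooted tree T_2: vertices are finite words over a 2-letter  *)
(* alphabet (here bool), root = empty word, edges u -- u x.               *)
Definition word := seq bool.

Definition tree_adj (v w : word) : Prop :=
  (exists x, w = rcons v x) \/ (exists x, v = rcons w x).

Definition is_tree_aut (f : word -> word) : Prop :=
  bijective f /\ f [::] = [::] /\
  (forall v w, tree_adj v w <-> tree_adj (f v) (f w)).

(* state (section) of f at the first-level vertex x:                       *)
(* f (x w) = sigma(x) f_x(w)                                              *)
Definition state (f : word -> word) (x : bool) : word -> word :=
  fun w => behead (f (x :: w)).

Inductive inQ (f : word -> word) : (word -> word) -> Prop :=
| inQ_self g : g =1 f -> inQ f g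
| inQ_state x g : inQ (state f x) g -> inQ f g.

Definition finite_state (f : word -> word) : Prop :=
  exists l : seq (word -> word),
    forall g, inQ f g -> exists2 h, List.In h l & g =1 h.

Definition in_F2 (f : word -> word) : Prop := is_tree_aut f /\ finite_state f.

Inductive gen (S : seq (word -> word)) : (word -> word) -> Prop :=
| gen_id : gen S id
| gen_mul s f : List.In s S -> gen S f -> gen S (s \o f)
| gen_inv s s' f : List.In s S -> cancel s s' -> cancel s' s -> gen S f ->
    gen S (s' \o f).

Definition self_similar (G : (word -> word) -> Prop) : Prop :=
  forall f, G f -> forall g, inQ f g -> G g.

Definition automata_group (G : (word -> word) -> Prop) : Prop :=
  (forall f, G f -> in_F2 f) /\
  (exists S : seq (word -> word),
      forall f, G f <-> exists2 g, gen S g & f =1 g) /\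
  self_similar G.

(* Main.v *)
Require Import Defs.
From mathcomp Require Import all_boot all_order all_algebra.
From mathcomp Require Import finmap zify.
From Stdlib Require List.

(* Read a binary word as a sequence of finite segments
     W_0 # Y_0 # Z_0 # W_1 # Y_1 # Z_1 # ...
   and view each segment as an integer modulo 2^length, least digit first. Let
   t add 1 to every W_l, let b add 1 to Y_l whenever W_l = 0, and let a add 1 to
   Z_l whenever W_0 = Y_0 = ... = Y_l = 0. All three are finite-state. The maps
   t^i b t^-i add the indicator of W_l = i to Y_l, hence commute, and t and b
   generate a quotient of Z wr Z, whose conjugates of a commute in the same way
   since they only add to the Z_l integers depending on the W's and Y's.
   The resulting action of Z wr (Z wr Z) is faithful because a word has room for
   many counters W_l: for finitely many g <> 1 in Z wr Z some word satisfies the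
   condition tested by a while its images under these g do not, so the functions
   of a word defining the conjugates of a are linearly independent over Z. *)

Set Implicit Arguments.
Unset Strict Implicit.
Unset Printing Implicit Defensive.

Import Order.TTheory GRing.Theory Num.Theory.

(** * Restricted wreath products *)

Section WreathGroup.
Local Open Scope fset_scope.
Local Open Scope ring_scope.

Record group_laws (T : choiceType) (mul : T -> T -> T) (inv : T -> T)
    (one : T) : Prop := GroupLaws {
    glA : forall x y z, mul x (mul y z) = mul (mul x y) z;
    gl1l : forall x, mul one x = x;
    gl1r : forall x, mul x one = x;
    glVl : forall x, mul (inv x) x = one;
    glVr : forall x, mul x (inv x) = one }.

Lemma int_group_laws :
  group_laws (fun a b : int => a + b) (fun a => - a) 0.
Proof. split=> *; rewrite ?addrA ?add0r ?addr0 ?addNr ?subrr //. Qed.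

Variables (T : choiceType) (mul : T -> T -> T) (inv : T -> T) (one : T).
Hypothesis gT : group_laws mul inv one.

Let mulA := glA gT.
Let mul1l := gl1l gT.
Let mul1r := gl1r gT.
Let mulVl := glVl gT.
Let mulVr := glVr gT.

Lemma gl_mulKl x y : mul (inv x) (mul x y) = y.
Proof. by rewrite mulA mulVl mul1l. Qed.

Lemma gl_mulVKl x y : mul x (mul (inv x) y) = y.
Proof. by rewrite mulA mulVr mul1l. Qed.

Lemma gl_invK x : inv (inv x) = x.
Proof. by rewrite -[RHS](gl_mulKl (inv x)) mulVl mul1r. Qed.

Lemma gl_invM x y : inv (mul x y) = mul (inv y) (inv x).
Proof.
have e : mul (mul x y) (mul (inv y) (inv x)) = one.
  by rewrite -mulA gl_mulVKl mulVr.
by rewrite -[RHS](gl_mulKl (mul x y)) e mul1r.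
Qed.

Lemma gl_inv1 : inv one = one.
Proof. by rewrite -[LHS]mul1l mulVr. Qed.

Lemma wbase0E x : wbase0 T x = 0.
Proof. by rewrite fsfunE. Qed.

Lemma wbase_addE (f g : wbase T) x : wbase_add f g x = f x + g x.
Proof.
rewrite fsfunE in_fsetU.
by case: finsuppP => [_|_] //=; case: finsuppP => [_|_]; rewrite ?addr0.
Qed.

Lemma wbase_oppE (f : wbase T) x : wbase_opp f x = - f x.
Proof. by rewrite fsfunE; case: finsuppP => // _; rewrite oppr0. Qed.

Lemma wshiftE b (f : wbase T) x : wshift mul inv b f x = f (mul (inv b) x).
Proof.
rewrite fsfunE; case: ifPn => // /imfsetP/= nx.
rewrite fsfun_dflt //; apply/negP => sx; apply: nx.
by exists (mul (inv b) x); rewrite // gl_mulVKl.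
Qed.

Lemma wr_group_laws :
  group_laws (wr_mul mul inv) (wr_inv mul inv) (wr_one one).
Proof.
split=> [[f a] [g b] [h c]|[f a]|[f a]|[f a]|[f a]];
  rewrite /wr_mul /wr_inv /wr_one /=; congr pair; rewrite ?mulA //;
  apply/fsfunP => x; rewrite !(wbase_addE, wshiftE, wbase_oppE, wbase0E).
- by rewrite addrA gl_invM mulA.
- by rewrite gl_inv1 mul1l add0r.
- by rewrite addr0.
- by rewrite addNr.
- by rewrite gl_invK gl_mulVKl subrr.
Qed.

Lemma big_finsupp (f : wbase T) (A : {fset T}) (F : T -> int) :
  finsupp f `<=` A ->
  \sum_(k <- finsupp f) f k * F k = \sum_(k <- A) f k * F k.
Proof.
move=> sfA; apply: big_fset_incl => // x _ xf.
by rewrite fsfun_dflt // mul0r.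
Qed.

Lemma big_wbase_add (f g : wbase T) (F : T -> int) :
  \sum_(k <- finsupp (wbase_add f g)) wbase_add f g k * F k =
  \sum_(k <- finsupp f) f k * F k + \sum_(k <- finsupp g) g k * F k.
Proof.
have s : finsupp (wbase_add f g) `<=` finsupp f `|` finsupp g.
  apply/fsubsetP => x; rewrite in_fsetU !mem_finsupp wbase_addE.
  by apply: contraNT; rewrite negb_or !negbK => /andP[/eqP-> /eqP->].
rewrite (big_finsupp _ s) (big_finsupp _ (fsubsetUl _ (finsupp g))).
rewrite (big_finsupp _ (fsubsetUr (finsupp f) _)) -big_split /=.
by apply: eq_bigr => k _; rewrite wbase_addE mulrDl.
Qed.

Lemma big_wshift (f : wbase T) b (F : T -> int) :
  \sum_(k <- finsupp (wshift mul inv b f)) wshift mul inv b f k * F k =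
  \sum_(k <- finsupp f) f k * F (mul b k).
Proof.
pose A := [fset mul b y | y in finsupp f].
have s : finsupp (wshift mul inv b f) `<=` A.
  apply/fsubsetP => x; rewrite mem_finsupp wshiftE -mem_finsupp => h.
  by apply/imfsetP; exists (mul (inv b) x); rewrite //= gl_mulVKl.
rewrite (big_finsupp _ s) big_imfset /=; last first.
  by move=> x y _ _ e; rewrite -(gl_mulKl b x) e gl_mulKl.
by apply: eq_bigr => k _; rewrite wshiftE gl_mulKl.
Qed.

End WreathGroup.

(* A restricted wreath product acts on O as soon as T acts through psi, an
   abelian group acts through alpha (indexed by functions I -> int), the two
   actions commute and chi : O -> (I -> int) is alpha-invariant: the generator
   of the base group is w |-> alpha (chi w) w, and its conjugate by psi k is
   w |-> alpha (chi (psi k^-1 w)) w. *)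
Section WreathAction.
Local Open Scope ring_scope.

Variables (T : choiceType) (mul : T -> T -> T) (inv : T -> T) (one : T).
Hypothesis gT : group_laws mul inv one.
Variables (O I : Type) (alpha : (I -> int) -> O -> O) (chi : O -> I -> int).
Variable psi : T -> O -> O.

Definition wr_coef (f : wbase T) (w : O) (j : I) : int :=
  \sum_(k <- finsupp f) f k * chi (psi (inv k) w) j.

Definition wr_act (u : wr T) (w : O) : O :=
  alpha (wr_coef u.1 (psi u.2 w)) (psi u.2 w).

Hypothesis alpha_ext : forall k l w, k =1 l -> alpha k w = alpha l w.
Hypothesis alpha0 : forall w, alpha (fun=> 0) w = w.
Hypothesis alphaD : forall k l w,
  alpha k (alpha l w) = alpha (fun j => k j + l j) w.
Hypothesis psi1 : forall w, psi one w = w.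
Hypothesis psiM : forall a b w, psi (mul a b) w = psi a (psi b w).
Hypothesis psi_alpha : forall a k w, psi a (alpha k w) = alpha k (psi a w).
Hypothesis chi_alpha : forall k w j, chi (alpha k w) j = chi w j.

Lemma psiVK a w : psi a (psi (inv a) w) = w.
Proof. by rewrite -psiM (glVr gT) psi1. Qed.

Lemma psiKV a w : psi (inv a) (psi a w) = w.
Proof. by rewrite -psiM (glVl gT) psi1. Qed.

Lemma wr_coef_alpha f k w j : wr_coef f (alpha k w) j = wr_coef f w j.
Proof. by apply: eq_bigr => i _; rewrite psi_alpha chi_alpha. Qed.

Lemma wr_act1 w : wr_act (wr_one one) w = w.
Proof.
rewrite /wr_act /= psi1 -[RHS]alpha0; apply: alpha_ext => j.
by rewrite /wr_coef big1_fset // => i _ _; rewrite wbase0E mul0r.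
Qed.

Lemma wr_actM u v w : wr_act (wr_mul mul inv u v) w = wr_act u (wr_act v w).
Proof.
rewrite /wr_act /= !psi_alpha psiM alphaD; apply: alpha_ext => j.
rewrite wr_coef_alpha {1}/wr_coef (big_wbase_add _) (big_wshift gT).
congr +%R; apply: eq_bigr => k _.
by rewrite (gl_invM gT) psiM psiKV.
Qed.

(** [wr_act (f, a)] is [psi a] followed by a finite product of conjugates under [psi k] of powers of
    the base generator, so only [psi] and these powers have to be checked. *)
Lemma wr_act_closed (P : (O -> O) -> Prop) :
  (forall f g, P f -> f =1 g -> P g) -> P id ->
  (forall f g, P f -> P g -> P (f \o g)) ->
  (forall a, P (psi a)) ->
  (forall c : int, P (fun w => alpha (fun j => c * chi w j) w)) ->
  forall u, P (wr_act u).
Proof.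
move=> Pext P1 PM Ppsi Pchi [f a].
suff Ps (s : seq T) :
    P (fun w => alpha (fun j => \sum_(k <- s) f k * chi (psi (inv k) w) j) w).
  by apply: (PM _ (psi a) (Ps (finsupp f)) (Ppsi a)).
elim: s => [|k s Ps].
  apply: Pext P1 _ => w; rewrite -[LHS]alpha0; apply: alpha_ext => j.
  by rewrite big_nil.
have Pk := PM _ _ (PM _ _ (Ppsi k) (Pchi (f k))) (Ppsi (inv k)).
apply: Pext (PM _ _ Pk Ps) _.
move=> w /=; rewrite psi_alpha psiVK !psi_alpha alphaD.
apply: alpha_ext => j; rewrite big_cons chi_alpha.
by [].
Qed.

End WreathAction.

(** * Mealy automata on binary words *)

Lemma In_map_mem (A : eqType) (B : Type) (f : A -> B) s x :
  x \in s -> List.In (f x) (map f s).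
Proof.
elim: s => //= y s IH; rewrite inE => /orP[/eqP->|/IH]; by [left | right].
Qed.

Lemma In_mapP (A B : Type) (f : A -> B) s y :
  List.In y (map f s) -> exists x, y = f x.
Proof. by elim: s => //= x s IH [<-|/IH //]; exists x. Qed.

Section Mealy.

Variables (Q : finType) (flip : Q -> bool) (next : Q -> bool -> Q).

(* With d = true this is the inverse automaton: same states and flips, but the
   transitions read the output letter. *)
Fixpoint run (d : bool) (q : Q) (w : word) : word :=
  if w is b :: w' then
    (b (+) flip q) :: run d (next q (if d then b (+) flip q else b)) w'
  else [::].

Lemma runK d q : cancel (run d q) (run (~~ d) q).
Proof.
by move=> w; elim: w q => //= b w IH q; rewrite addbK; case: d IH => /= ->.
Qed.

Lemma run_rcons d q w x : exists y, run d q (rcons w x) = rcons (run d q w) y.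
Proof.
elim: w q => [|b w IH] q /=; first by exists (x (+) flip q).
by have [y ->] := IH (next q (if d then b (+) flip q else b)); exists y.
Qed.

Lemma run_tree_adj d q v w :
  tree_adj v w -> tree_adj (run d q v) (run d q w).
Proof.
case=> [] [x ->].
  by have [y ->] := run_rcons d q v x; left; exists y.
by have [y ->] := run_rcons d q w x; right; exists y.
Qed.

Definition run_seq (s : seq (bool * Q)) : word -> word :=
  foldr (fun p f => run p.1 p.2 \o f) id s.

Definition mealy_gens : seq (word -> word) :=
  [seq run p.1 p.2 | p <- enum {: bool * Q}].

Definition mealy_group (f : word -> word) : Prop :=
  exists2 g, gen mealy_gens g & f =1 g.

Lemma mealy_gensP d q : List.In (run d q) mealy_gens.
Proof.
have dq : (d, q) \in enum {: bool * Q} by rewrite mem_enum.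
exact: (In_map_mem (fun p => run p.1 p.2) dq).
Qed.

(** The inverse of [run d q] is [run (~~ d) q], so products of runs already exhaust the generated
    group. *)
Lemma mealy_groupP f : mealy_group f <-> exists s, f =1 run_seq s.
Proof.
split=> [[g Gg fg]|[s fs]].
  suff [s gs] : exists s, g =1 run_seq s by exists s => w; rewrite fg gs.
  clear f fg; induction Gg as [|r f Sr _ [s fs]|r r' f Sr rK _ _ [s fs]].
  - by exists [::].
  - have [p ->] := In_mapP Sr.
    by exists (p :: s) => w /=; rewrite fs.
  - have [p rE] := In_mapP Sr; exists ((~~ p.1, p.2) :: s) => w /=; rewrite fs.
    (* The abstract inverse [r'] is identified pointwise with the reversed automaton by cancelling
       [r]. *)
    by rewrite -{1}(runK (~~ p.1) p.2 (run_seq s w)) negbK -rE rK.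
exists (run_seq s) => //; elim: s {fs} => [|p s IH]; first exact: gen_id.
by apply: gen_mul => //; apply: mealy_gensP.
Qed.

Lemma mealy_group_ext f g : mealy_group f -> f =1 g -> mealy_group g.
Proof. by case=> h Gh fh fg; exists h => // w; rewrite -fg. Qed.

Lemma mealy_group_id : mealy_group id.
Proof. by exists id => //; apply: gen_id. Qed.

Lemma mealy_group_run d q : mealy_group (run d q).
Proof. by apply/mealy_groupP; exists [:: (d, q)]. Qed.

Lemma mealy_group_comp f g :
  mealy_group f -> mealy_group g -> mealy_group (f \o g).
Proof.
move=> /mealy_groupP[s fs] /mealy_groupP[r gr]; apply/mealy_groupP.
exists (s ++ r) => w /=; rewrite gr fs; elim: s {fs} => //= p s ->.
by [].
Qed.

Lemma run_seq_cons s x :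
  exists b s', size s' = size s /\
    forall w, run_seq s (x :: w) = b :: run_seq s' w.
Proof.
elim: s => [|p s [b [s' [ss' e]]]] /=; first by exists x, [::].
exists (b (+) flip p.2).
exists ((p.1, next p.2 (if p.1 then b (+) flip p.2 else b)) :: s').
by rewrite /= ss'; split=> // w; rewrite e.
Qed.

(** Passing to a state keeps the number of factors, and there are finitely many products of a given
    length. This gives both finiteness of states and self-similarity. *)
Lemma inQ_run_seq f g : inQ f g ->
  forall s, f =1 run_seq s -> exists2 s', size s' = size s & g =1 run_seq s'.
Proof.
elim=> {f g} [f g gf|f x g _ IH] s fs; first by exists s => // w; rewrite gf.
have [b [s' [ss' e]]] := run_seq_cons s x.
have [w|r rs gr] := IH s'; first by rewrite /state fs e.
by exists r => //; rewrite rs.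
Qed.

Lemma run_seq_tree_aut s : is_tree_aut (run_seq s).
Proof.
pose s' := rev [seq (~~ p.1, p.2) | p <- s].
have catE (s1 s2 : seq (bool * Q)) :
    run_seq (s1 ++ s2) =1 run_seq s1 \o run_seq s2.
  by move=> w; elim: s1 => //= p s1 ->.
have K1 : cancel (run_seq s) (run_seq s').
  rewrite /s'; elim: (s) => //= p r IH w.
  by rewrite rev_cons -cats1 catE /= runK IH.
have K2 : cancel (run_seq s') (run_seq s).
  rewrite /s'; elim: (s) => //= p r IH w.
  rewrite rev_cons -cats1 catE /= IH.
  by rewrite -{1}(negbK p.1) runK.
have adj r v w : tree_adj v w -> tree_adj (run_seq r v) (run_seq r w).
  by elim: r => //= p r IH /IH; apply: run_tree_adj.
split; first by exists (run_seq s').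
split=> [|v w]; first by elim: (s) => //= p r ->.
by split=> [/adj //|/(adj s')]; rewrite !K1.
Qed.

Lemma mealy_group_F2 f : mealy_group f -> in_F2 f.
Proof.
move=> /mealy_groupP[s fs]; split.
  have [[g K1 K2] [e1 adj]] := run_seq_tree_aut s.
  split; last by split=> [|v w]; rewrite !fs.
  by exists g => w; rewrite fs.
exists [seq run_seq (val t) | t <- enum {: (size s).-tuple (bool * Q)}] => g fg.
have [r rs gr] := inQ_run_seq fg fs; exists (run_seq r) => //.
have tr : size r == size s by apply/eqP.
have rT : Tuple tr \in enum {: (size s).-tuple (bool * Q)} by rewrite mem_enum.
exact: (In_map_mem (fun t => run_seq (val t)) rT).
Qed.

Lemma mealy_group_automata_group : automata_group mealy_group.
Proof.
split; first exact: mealy_group_F2.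
split; first by exists mealy_gens.
move=> f /mealy_groupP[s fs] g fg; have [r _ gr] := inQ_run_seq fg fs.
by apply/mealy_groupP; exists r.
Qed.

End Mealy.

(** * Addition on the segments of a word *)

Section Segments.
Local Open Scope ring_scope.

Definition digit (k : int) (v : bool) : bool := ((k + v%:Z) %% 2)%Z == 1.
Definition carry (k : int) (v : bool) : int := ((k + v%:Z) %/ 2)%Z.

(** Addition modulo 2^length, least digit first. The carry is an arbitrary integer, so one formula
    covers all powers of a generator, negative ones included. *)
Fixpoint addw (k : int) (s : word) : word :=
  if s is v :: s' then digit k v :: addw (carry k v) s' else [::].

Lemma digit0 v : digit 0 v = v. Proof. by case: v. Qed.
Lemma carry0 v : carry 0 v = 0. Proof. by case: v. Qed.

Lemma digitD k l v : digit k (digit l v) = digit (k + l) v.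
Proof. by rewrite /digit; case: v; lia. Qed.

Lemma carryD k l v : carry k (digit l v) + carry l v = carry (k + l) v.
Proof. by rewrite /carry /digit; case: v; lia. Qed.

Lemma addw0 s : addw 0 s = s.
Proof. by elim: s => //= v s IH; rewrite digit0 carry0 IH. Qed.

Lemma addwD k l s : addw k (addw l s) = addw (k + l) s.
Proof.
by elim: s k l => //= v s IH k l; rewrite digitD IH carryD.
Qed.

Definition zerow (s : word) := all negb s.

Lemma zerow_addw k n : zerow (addw k (nseq n false)) = (2 ^+ n %| k)%Z.
Proof.
elim: n k => [|n IH] k; first by rewrite dvd1z.
rewrite /= -/(zerow _) IH exprS /digit /carry.
apply/andP/idP => [[dk /dvdzP[q kE]]|/dvdzP[q kE]].
  by apply/dvdzP; exists q; lia.
split; first lia.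
by apply/dvdzP; exists q; lia.
Qed.

(* A word of bits is read as a sequence of segments separated by the letter 1,
   a digit v inside a segment being coded 0 v. *)
Fixpoint seg (j : nat) (w : word) : word :=
  match w with
  | true :: w' => if j is j'.+1 then seg j' w' else [::]
  | false :: v :: w' => if j is 0 then v :: seg j w' else seg j w'
  | _ => [::]
  end.

Definition set_head (c : int) (k : nat -> int) (j : nat) : int :=
  if j is 0 then c else k j.

(** [k j] is what remains to be added to segment j; overflow at a separator is discarded, and an
    incomplete last digit is left alone. *)
Fixpoint addsegs (k : nat -> int) (w : word) : word :=
  match w with
  | true :: w' => true :: addsegs (fun j => k j.+1) w'
  | false :: v :: w' =>
      false :: digit (k 0) v :: addsegs (set_head (carry (k 0) v) k) w'
  | _ => w
  end.

Lemma seg_ind (P : word -> Prop) :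
  P [::] -> P [:: false] -> (forall w, P w -> P (true :: w)) ->
  (forall v w, P w -> P [:: false, v & w]) -> forall w, P w.
Proof.
move=> P0 P1 Pt Pf w; have [n] := ubnP (size w).
elim: n w => // n IH [|[] w] //= sw; first exact/Pt/IH.
by case: w sw => // v w sw; apply/Pf/IH; apply: ltnW.
Qed.

Lemma addsegs_ext k l w : k =1 l -> addsegs k w = addsegs l w.
Proof.
elim/seg_ind: w k l => //= [w IH|v w IH] k l kl.
  by rewrite (IH _ _ (fun j => kl j.+1)).
by rewrite kl; congr [:: _, _ & _]; apply: IH => -[|j] //=.
Qed.

Lemma addsegs0 w : addsegs (fun=> 0) w = w.
Proof.
elim/seg_ind: w => //= [w ->|v w IH] //.
rewrite digit0 -{2}IH; congr [:: _, _ & _].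
by apply: addsegs_ext => -[|j] //=; rewrite carry0.
Qed.

Lemma addsegsD k l w :
  addsegs k (addsegs l w) = addsegs (fun j => k j + l j) w.
Proof.
elim/seg_ind: w k l => //= [w IH|v w IH] k l; first by rewrite IH.
rewrite digitD IH; congr [:: _, _ & _].
by apply: addsegs_ext => -[|j] //=; rewrite carryD.
Qed.

Lemma addsegsC k l w : addsegs k (addsegs l w) = addsegs l (addsegs k w).
Proof. by rewrite !addsegsD; apply: addsegs_ext => j; rewrite addrC. Qed.

Lemma seg_addsegs k w j : seg j (addsegs k w) = addw (k j) (seg j w).
Proof.
by elim/seg_ind: w k j => //= [w IH|v w IH] k [|j] //=; rewrite IH.
Qed.

End Segments.

(** * The three generators as states of one automaton *)

Section Generators.
Local Open Scope ring_scope.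

(* The segments of a word cyclically play three roles: (false, _) is a counter,
   (true, false) a Y-segment and (true, true) a Z-segment; the phase
   (false, false) marks the first counter. *)
Definition phase : finType := (bool * bool)%type.
Definition next_phase (p : phase) : phase :=
  if p.1 then (~~ p.2, true) else (true, false).
Definition phaseW (p : phase) := ~~ p.1.
Definition phaseY (p : phase) := p.1 && ~~ p.2.
Definition phaseZ (p : phase) := p.1 && p.2.
Definition ph (j : nat) : phase := iter j next_phase (false, false).

(* ((p, z), g): the phase of the current segment, whether its digits read so far
   vanish, and whether the first counter and all completed Y-segments vanish. *)
Definition control : finType := (phase * bool * bool)%type.
Definition read_digit (c : control) (v : bool) : control :=
  (c.1.1, c.1.2 && ~~ v, c.2).
Definition next_flag (c : control) : bool :=
  if c.1.1 == (false, false) then c.1.2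
  else if phaseY c.1.1 then c.2 && c.1.2 else c.2.
Definition read_sep (c : control) : control :=
  (next_phase c.1.1, true, next_flag c).

(* The increment that the generator e injects into the next segment: None is the
   generator of the bottom copy of Z, Some false that of the middle one and
   Some true that of the top one. *)
Definition inject (e : option bool) (c : control) : bool :=
  match e with
  | None => phaseZ c.1.1
  | Some false => phaseW c.1.1 && c.1.2
  | Some true => phaseY c.1.1 && next_flag c
  end.

(** The control state after segment j, before the separator that ends it. *)
Fixpoint ctl (c : control) (w : word) (j : nat) : control :=
  if j is j'.+1 then foldl read_digit (read_sep (ctl c w j')) (seg j w)
  else foldl read_digit c (seg 0 w).

(** The components are the generator, the control, the pending carry, and whether the second letter
    of a pair 0 v comes next. *)
Definition mstate : finType := (option bool * control * bool * bool)%type.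
Definition mflip (q : mstate) : bool :=
  let: (_, _, b, mid) := q in mid && b.
Definition mnext (q : mstate) (v : bool) : mstate :=
  let: (e, c, b, mid) := q in
  if mid then (e, read_digit c v, b && v, false)
  else if v then (e, read_sep c, inject e c, false) else (e, c, b, true).

Definition injections e (c : control) (b : bool) (w : word) (j : nat) : int :=
  if j is j'.+1 then (inject e (ctl c w j'))%:Z else b%:Z.

Lemma run_addsegs e c b w :
  run mflip mnext false (e, c, b, false) w = addsegs (injections e c b w) w.
Proof.
elim/seg_ind: w e c b => //= [w IH|v w IH] e c b; rewrite IH.
  congr cons; apply: addsegs_ext => -[|j] //=.
  congr (Posz (nat_of_bool (inject _ _))).
  by elim: j => //= j ->.
congr [:: _, _ & _]; first by case: b; case: v.
apply: addsegs_ext => -[|j] /=; first by case: b; case: v.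
congr (Posz (nat_of_bool (inject _ _))).
by elim: j => //= j ->.
Qed.

Definition c0 : control := (false, false, true, true).

Lemma foldl_read_digit c s :
  foldl read_digit c s = (c.1.1, c.1.2 && zerow s, c.2).
Proof.
elim: s c => [|v s IH] [[p z] g] /=; first by rewrite andbT.
by rewrite IH /= andbA.
Qed.

Definition flag (w : word) (j : nat) : bool := next_flag (ctl c0 w j).

Lemma ctl_phase w j : (ctl c0 w j).1.1 = ph j.
Proof. by elim: j => [|j IH] /=; rewrite foldl_read_digit //= IH. Qed.

Lemma ctl_zero w j : (ctl c0 w j).1.2 = zerow (seg j w).
Proof. by case: j => [|j] /=; rewrite foldl_read_digit. Qed.

Lemma flag0 w : flag w 0 = zerow (seg 0 w).
Proof. by rewrite /flag /next_flag ctl_phase ctl_zero. Qed.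

Lemma flagS w j :
  flag w j.+1 = flag w j && (phaseY (ph j.+1) ==> zerow (seg j.+1 w)).
Proof.
rewrite /flag [LHS]/next_flag ctl_phase ctl_zero [ctl _ _ _]/=.
rewrite foldl_read_digit /=.
by case: (ph j) => [[] []] /=; rewrite ?andbT.
Qed.

(** No separator precedes the first counter, so the bottom generator increments it through the
    initial carry. *)
Definition chi (e : option bool) (w : word) : nat -> int :=
  injections e c0 (e == None) w.

Lemma chi_tE w j : chi None w j = (phaseW (ph j))%:Z.
Proof. by case: j => //= j; rewrite ctl_phase; case: (ph j) => [[] []]. Qed.

Lemma chi_bE w j : chi (Some false) w j =
  if j is j'.+1 then (phaseW (ph j') && zerow (seg j' w))%:Z else 0.
Proof. by case: j => //= j; rewrite ctl_phase ctl_zero. Qed.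

Lemma chi_aE w j : chi (Some true) w j =
  if j is j'.+1 then (phaseY (ph j') && flag w j')%:Z else 0.
Proof. by case: j => //= j; rewrite ctl_phase. Qed.

(** Masking confines a translation to segments of one role, so tests that read only other segments
    are invariant under it. *)
Definition on_phase (P : pred phase) (k : nat -> int) (j : nat) : int :=
  if P (ph j) then k j else 0.

(** The increments of the middle generator already sit on Y-segments, so the masked action is still
    given by the automaton. *)
Lemma mask_chi_b c w :
  on_phase phaseY (fun j => c * chi (Some false) w j) =1
  (fun j => c * chi (Some false) w j).
Proof.
move=> j; rewrite /on_phase chi_bE; case: j => [|j] /=; first by rewrite mulr0.
by case: (ph j) => [[] []] /=; rewrite ?mulr0.
Qed.

Lemma mask_chi_a c w :
  on_phase phaseZ (fun j => c * chi (Some true) w j) =1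
  (fun j => c * chi (Some true) w j).
Proof.
move=> j; rewrite /on_phase chi_aE; case: j => [|j] /=; first by rewrite mulr0.
by case: (ph j) => [[] []] /=; rewrite ?mulr0.
Qed.

Lemma chi_b_seg w w' :
  (forall j, phaseW (ph j) -> seg j w = seg j w') ->
  chi (Some false) w =1 chi (Some false) w'.
Proof.
move=> ww' [|j]; rewrite !chi_bE //.
by case: (boolP (phaseW _)) => //= /ww' ->.
Qed.

Lemma flag_seg w w' :
  (forall j, ~~ phaseZ (ph j) -> seg j w = seg j w') -> flag w =1 flag w'.
Proof.
move=> ww'; elim=> [|j IH]; first by rewrite !flag0 ww'.
rewrite !flagS IH; case: (boolP (phaseY _)) => //= Yj.
by rewrite ww' //; move: Yj; rewrite /phaseY /phaseZ; case: (_.1); case: (_.2).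
Qed.

Lemma chi_a_seg w w' :
  (forall j, ~~ phaseZ (ph j) -> seg j w = seg j w') ->
  chi (Some true) w =1 chi (Some true) w'.
Proof. by move=> ww' [|j]; rewrite !chi_aE // (flag_seg ww'). Qed.

Lemma seg_addsegs_mask P k w j :
  ~~ P (ph j) -> seg j (addsegs (on_phase P k) w) = seg j w.
Proof. by move=> /negPf nP; rewrite seg_addsegs /on_phase nP addw0. Qed.

Lemma chi_b_mask P k w : (forall p, phaseW p -> ~~ P p) ->
  chi (Some false) (addsegs (on_phase P k) w) =1 chi (Some false) w.
Proof. by move=> WP; apply: chi_b_seg => j /WP; apply: seg_addsegs_mask. Qed.

Lemma chi_a_mask k w :
  chi (Some true) (addsegs (on_phase phaseZ k) w) =1 chi (Some true) w.
Proof. by apply: chi_a_seg => j; apply: seg_addsegs_mask. Qed.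

Definition autG := mealy_group mflip mnext.

(** A generator that does not alter its own increments has as c-th power the addition of c times
    these increments. *)
Lemma autG_power e :
  (forall (c : int) w, chi e (addsegs (fun j => c * chi e w j) w) =1 chi e w) ->
  forall c : int, autG (fun w => addsegs (fun j => c * chi e w j) w).
Proof.
move=> chiE; set q : mstate := (e, c0, e == None, false).
have rE w : run mflip mnext false q w = addsegs (chi e w) w.
  exact: run_addsegs.
pose pow (c : int) w := addsegs (fun j => c * chi e w j) w.
have step (c d : int) w : pow c (pow d w) = pow (c + d) w.
  rewrite /pow addsegsD; apply: addsegs_ext => j; rewrite chiE mulrDl.
  by [].
have r1 w : addsegs (chi e w) w = pow 1 w.
  by apply: addsegs_ext => j; rewrite mul1r.
elim/int_rect=> [|n IH|n IH].
- apply: mealy_group_ext (mealy_group_id _ _) _ => w.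
  by rewrite -[LHS]addsegs0; apply: addsegs_ext => j; rewrite mul0r.
- have := mealy_group_comp (mealy_group_run _ _ false q) IH.
  move/mealy_group_ext; apply=> w /=.
  by rewrite rE r1 -!/(pow _ _) step.
- have := mealy_group_comp (mealy_group_run _ _ true q) IH.
  move/mealy_group_ext; apply=> w /=.
  (* Both sides are compared after applying the forward automaton, which cancels its inverse. *)
  apply: (can_inj (runK mflip mnext false q)).
  rewrite [LHS](runK mflip mnext true q) rE r1 step.
  by apply: addsegs_ext => j; congr (_ * _); lia.
Qed.

End Generators.

(** * The action of the iterated wreath product *)

Section Representation.
Local Open Scope ring_scope.

Lemma W2_group_laws : group_laws W2_mul W2_inv W2_one.
Proof. exact: wr_group_laws int_group_laws. Qed.

Definition Z_act (n : int) (w : word) : word :=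
  addsegs (fun j => n * chi None w j) w.

Definition addY (k : nat -> int) : word -> word := addsegs (on_phase phaseY k).
Definition addZ (k : nat -> int) : word -> word := addsegs (on_phase phaseZ k).

Definition W2_act : W2 -> word -> word :=
  @wr_act int (fun n => - n) word nat addY (chi (Some false)) Z_act.

Definition W3_act : W3 -> word -> word :=
  @wr_act W2 W2_inv word nat addZ (chi (Some true)) W2_act.

Lemma add_mask_ext P k l w :
  k =1 l -> addsegs (on_phase P k) w = addsegs (on_phase P l) w.
Proof. by move=> kl; apply: addsegs_ext => j; rewrite /on_phase kl. Qed.

Lemma add_mask0 P w : addsegs (on_phase P (fun=> 0)) w = w.
Proof.
by rewrite -[RHS]addsegs0; apply: addsegs_ext => j; rewrite /on_phase if_same.
Qed.

Lemma add_maskD P k l w :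
  addsegs (on_phase P k) (addsegs (on_phase P l) w) =
  addsegs (on_phase P (fun j => k j + l j)) w.
Proof.
by rewrite addsegsD; apply: addsegs_ext => j; rewrite /on_phase; case: ifP.
Qed.

Lemma Z_actE n w : Z_act n w = addsegs (fun j => n * (phaseW (ph j))%:Z) w.
Proof. by apply: addsegs_ext => j; rewrite chi_tE. Qed.

Lemma Z_act1 w : Z_act 0 w = w.
Proof.
by rewrite Z_actE -[RHS]addsegs0; apply: addsegs_ext => j; rewrite mul0r.
Qed.

Lemma Z_actM a b w : Z_act (a + b) w = Z_act a (Z_act b w).
Proof.
by rewrite !Z_actE addsegsD; apply: addsegs_ext => j; rewrite mulrDl.
Qed.

Lemma Z_act_addsegs a k w : Z_act a (addsegs k w) = addsegs k (Z_act a w).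
Proof. by rewrite !Z_actE addsegsC. Qed.

Lemma chi_b_addY k w : chi (Some false) (addY k w) =1 chi (Some false) w.
Proof. by apply: chi_b_mask => -[[] []]. Qed.

Lemma chi_b_addZ k w : chi (Some false) (addZ k w) =1 chi (Some false) w.
Proof. by apply: chi_b_mask => -[[] []]. Qed.

Lemma W2_act_1 w : W2_act W2_one w = w.
Proof.
by apply: wr_act1; [apply: add_mask_ext | apply: add_mask0 | apply: Z_act1].
Qed.

Lemma W2_act_mul u v w : W2_act (W2_mul u v) w = W2_act u (W2_act v w).
Proof.
apply: wr_actM.
- exact: int_group_laws.
- exact: add_mask_ext.
- exact: add_maskD.
- exact: Z_act1.
- exact: Z_actM.
- by move=> *; apply: Z_act_addsegs.
- exact: chi_b_addY.
Qed.

(** The increments made by [u] depend only on the counters, which [addZ] fixes, and additions on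
    segments commute. *)
Lemma W2_act_addZ u k w : W2_act u (addZ k w) = addZ k (W2_act u w).
Proof.
rewrite /W2_act /wr_act /addZ Z_act_addsegs [RHS]addsegsC.
apply: add_mask_ext => j; rewrite /wr_coef; apply: eq_bigr => i _.
by rewrite Z_act_addsegs chi_b_addZ.
Qed.

Lemma W3_act_mul u v w : W3_act (W3_mul u v) w = W3_act u (W3_act v w).
Proof.
apply: wr_actM.
- exact: W2_group_laws.
- exact: add_mask_ext.
- exact: add_maskD.
- exact: W2_act_1.
- exact: W2_act_mul.
- exact: W2_act_addZ.
- exact: chi_a_mask.
Qed.

Lemma autG_Z_act n : autG (Z_act n).
Proof. by apply: autG_power => c w j; rewrite !chi_tE. Qed.

Lemma autG_addY (c : int) :
  autG (fun w => addY (fun j => c * chi (Some false) w j) w).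
Proof.
have E w : addY (fun j => c * chi (Some false) w j) w =
    addsegs (fun j => c * chi (Some false) w j) w.
  exact/addsegs_ext/mask_chi_b.
apply: mealy_group_ext (autG_power _ c) _ => [d w j|w]; last by rewrite E.
by rewrite -(addsegs_ext _ (mask_chi_b d w)) chi_b_addY.
Qed.

Lemma autG_addZ (c : int) :
  autG (fun w => addZ (fun j => c * chi (Some true) w j) w).
Proof.
have E w : addZ (fun j => c * chi (Some true) w j) w =
    addsegs (fun j => c * chi (Some true) w j) w.
  exact/addsegs_ext/mask_chi_a.
apply: mealy_group_ext (autG_power _ c) _ => [d w j|w]; last by rewrite E.
by rewrite -(addsegs_ext _ (mask_chi_a d w)) chi_a_mask.
Qed.

Lemma autG_W2_act u : autG (W2_act u).
Proof.
apply: (wr_act_closed int_group_laws _ _ _ Z_act1 Z_actM).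
- exact: add_mask_ext.
- exact: add_mask0.
- exact: add_maskD.
- by move=> *; apply: Z_act_addsegs.
- exact: chi_b_addY.
- exact: mealy_group_ext.
- exact: mealy_group_id.
- exact: mealy_group_comp.
- exact: autG_Z_act.
- exact: autG_addY.
Qed.

Lemma autG_W3_act u : autG (W3_act u).
Proof.
apply: (wr_act_closed W2_group_laws _ _ _ W2_act_1 W2_act_mul).
- exact: add_mask_ext.
- exact: add_mask0.
- exact: add_maskD.
- exact: W2_act_addZ.
- exact: chi_a_mask.
- exact: mealy_group_ext.
- exact: mealy_group_id.
- exact: mealy_group_comp.
- exact: autG_W2_act.
- exact: autG_addZ.
Qed.

End Representation.

(** * Faithfulness of the action *)

Section Faithfulness.
Local Open Scope ring_scope.

Lemma seg_Z_act n w j :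
  seg j (Z_act n w) = addw (n * (phaseW (ph j))%:Z) (seg j w).
Proof. by rewrite Z_actE seg_addsegs. Qed.

Lemma seg_W2_act_W h n w j :
  phaseW (ph j) -> seg j (W2_act (h, n) w) = addw n (seg j w).
Proof.
move=> Wj; rewrite seg_addsegs_mask ?seg_Z_act ?Wj ?mulr1 //.
by move: Wj; rewrite /phaseW /phaseY; case: (_.1).
Qed.

Lemma seg_W2_act_Z g w j : phaseZ (ph j) -> seg j (W2_act g w) = seg j w.
Proof.
case: g => h n; rewrite /phaseZ => /andP[p1 p2].
rewrite seg_addsegs_mask /phaseY ?p1 ?p2 // seg_Z_act.
by rewrite /phaseW p1 mulr0 addw0.
Qed.

(** The conjugate of the middle generator by the i-th power of the bottom one tests whether the
    counter equals i modulo 2^length, so the Y-segment receives the values of [h] at all such i. *)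
Lemma seg_W2_act_Y h w j : phaseW (ph j) ->
  seg j.+1 (W2_act (h, 0) w) =
  addw (\sum_(i <- finsupp h) h i * (zerow (addw (- i) (seg j w)))%:Z)
    (seg j.+1 w).
Proof.
move=> Wj; have Yj : phaseY (ph j.+1).
  by move: Wj; rewrite /phaseW /=; case: (ph j) => [[] []].
rewrite /W2_act /wr_act /= Z_act1 seg_addsegs /on_phase Yj; congr addw.
rewrite /wr_coef; apply: eq_bigr => i _.
by rewrite chi_bE Wj seg_Z_act Wj mulr1.
Qed.

Lemma flagP w j : flag w j <-> zerow (seg 0 w) /\
  forall i, (i <= j)%N -> phaseY (ph i) -> zerow (seg i w).
Proof.
elim: j => [|j IH].
  by rewrite flag0; split=> [?|[]//]; split=> // -[].
rewrite flagS; split=> [/andP[/IH[z0 zs] /implyP zj]|[z0 zs]].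
  split=> // i; rewrite leq_eqVlt => /orP[/eqP->//|]; exact: zs.
apply/andP; split; last by apply/implyP => ?; apply: zs.
by apply/IH; split=> // i ij; apply/zs/leqW.
Qed.

Lemma ph_mod3 l :
  [/\ phaseW (ph (3 * l)), phaseY (ph (3 * l).+1) & phaseZ (ph (3 * l).+2)].
Proof.
elim: l => // l []; rewrite mulnS !addSn /=.
by case: (ph (3 * l)) => [[] []].
Qed.

Fixpoint of_segs (F : nat -> word) (n : nat) : word :=
  foldr (fun v t => [:: false, v & t])
    (if n is n'.+1 then true :: of_segs (fun j => F j.+1) n' else [::]) (F 0).

Lemma seg_of_segs F n j : (j <= n)%N -> seg j (of_segs F n) = F j.
Proof.
have seg_enc s t i : seg i (foldr (fun v t => [:: false, v & t]) t s) =
    if i is 0 then s ++ seg 0 t else seg i t.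
  by elim: s => [|v s IH] /=; [case: i | case: i IH => //= ->].
elim: n F j => [|n IH] F [|j] //= jn; rewrite seg_enc ?cats0 //=.
exact: IH.
Qed.

(** Provides a segment length at which finitely many nonzero integers stay nonzero; it suffices that
    L >= |d|, as 2^|d| > |d|. *)
Lemma pow2_ndvd (D : seq int) :
  exists L, forall d, d \in D -> d != 0 -> ~~ (2 ^+ L %| d)%Z.
Proof.
elim: D => [|d D [L LD]]; first by exists 0%N.
exists (maxn L `|d|) => e; rewrite inE => /orP[/eqP->|/LD h] e0; last first.
  apply: contra (h e0); apply: dvdz_trans; apply/dvdzP.
  exists (2 ^+ (maxn L `|d| - L)); rewrite -exprD subnK //; exact: leq_maxl.
rewrite dvdzE abszX; apply/negP => /dvdn_leq; rewrite absz_gt0 => /(_ e0).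
rewrite leqNgt => /negP; apply.
exact: leq_trans (ltn_expl _ (isT : (1 < 2)%N))
  (leq_pexp2l (isT : (0 < 2)%N) (leq_maxr L `|d|)).
Qed.

(* In the separating word the counters run over 0 and the supports of all the
   g in F modulo a large power of 2, and the Y-segments vanish; hence g moves
   either the first counter or the Y-segment following some counter. *)
Lemma separating_word (F : seq W2) (c : int) :
  W2_one \notin F -> exists w j, [/\ phaseZ (ph j), chi (Some true) w j = 1,
    (forall g, g \in F -> chi (Some true) (W2_act g w) j = 0) &
    c != 0 -> addw c (seg j w) != seg j w].
Proof.
move=> nF.
pose is' : seq int := flatten [seq enum_fset (finsupp g.1) | g : W2 <- F].
(* All integers that must not vanish modulo 2^L unless they are 0: [c], the shifts, the values of
   the base functions, and the differences of support points. *)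
pose D := [:: c] ++ [seq g.2 | g : W2 <- F] ++
  flatten [seq [seq g.1 i | i <- is'] | g : W2 <- F] ++
  [seq i - i' | i <- is', i' <- is'].
have [L LD] := pow2_ndvd D.
pose zs := nseq L false.
pose S j := if phaseW (ph j) then addw (nth 0 (0 :: is') (j %/ 3)) zs else zs.
(* There are [size is'] + 1 counters, because 0 is put in front; the last index is that of the final
   Z-segment. *)
pose w := of_segs S (3 * size is').+2.
have segW l : (l <= size is')%N -> seg (3 * l) w = addw (nth 0 (0 :: is') l) zs.
  move=> ls; rewrite seg_of_segs; last by lia.
  by have [Wl _ _] := ph_mod3 l; rewrite /S Wl mulKn.
have segnW j : (j <= (3 * size is').+2)%N -> ~~ phaseW (ph j) -> seg j w = zs.
  by move=> js /negPf nW; rewrite seg_of_segs // /S nW.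
have zzs : zerow zs by rewrite -[zs]addw0 zerow_addw dvdz0.
have [_ Ym Zm] := ph_mod3 (size is').
have YnW p : phaseY p -> ~~ phaseW p by case: p => [[] []].
exists w, (3 * size is').+2; split=> //.
- rewrite chi_aE Ym /=; suff -> : flag w (3 * size is').+1 by [].
  apply/flagP; split; first by rewrite (segW 0%N) //= addw0.
  by move=> i im /YnW nW; rewrite segnW //; apply: leqW.
- move=> [h n] gF; rewrite chi_aE Ym /=.
  suff /negPf-> : ~~ flag (W2_act (h, n) w) (3 * size is').+1 by [].
  apply/negP => /flagP[z0 zY].
  (* A nonzero shift would move the first counter away from 0. *)
  have n0 : n = 0.
    apply/eqP/negPn/negP => nn0.
    have nD : n \in D.
      rewrite !mem_cat; apply/orP; right; apply/orP; left.
      by apply/mapP; exists (h, n).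
    move: z0; rewrite seg_W2_act_W // (segW 0%N) //= addwD addr0 zerow_addw.
    exact/negP/LD.
  rewrite n0 in gF z0 zY.
  have [h0|[i ih]] := fset_0Vmem (finsupp h).
    move/negP: nF; apply; suff <- : ((h, 0) : W2) = W2_one by [].
    congr pair; apply/fsfunP => x; rewrite wbase0E fsfun_dflt //.
    by rewrite h0 in_fset0.
  have his x : x \in finsupp h -> x \in is'.
    move=> xh; apply/flattenP; exists (enum_fset (finsupp h)) => //.
    by apply/mapP; exists (h, 0).
  (* Counter l holds the support point i, so the Y-segment after it detects [h i]. *)
  pose l := index i (0 :: is').
  have il : i \in 0 :: is' by rewrite inE his ?orbT.
  have ls : (l <= size is')%N by rewrite -index_mem in il.
  have li : nth 0 (0 :: is') l = i by rewrite nth_index.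
  have [Wl Yl _] := ph_mod3 l.
  have := zY (3 * l).+1; rewrite seg_W2_act_Y // segW // li.
  rewrite segnW ?YnW //; last first.
    by lia.
  (* Distinct support points stay distinct modulo 2^L, so only k = i contributes. *)
  suff -> : \sum_(k <- finsupp h) h k * (zerow (addw (- k) (addw i zs)))%:Z
      = h i.
    rewrite zerow_addw => /(_ _ Yl) hd.
    have : h i \in D.
      rewrite !mem_cat; apply/orP; right; apply/orP; right; apply/orP; left.
      apply/flattenP; exists [seq h x | x <- is']; last exact/map_f/his.
      by apply/mapP; exists (h, 0).
    move=> /LD; rewrite -mem_finsupp => /(_ ih); rewrite hd //.
    by lia.
  rewrite (big_fsetD1 i) //= addwD addNr addw0 zzs mulr1.
  rewrite big1_fset ?addr0 // => x; rewrite in_fsetD1 => /andP[xi xh] _.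
  rewrite addwD zerow_addw.
  have /LD : - x + i \in D.
    rewrite !mem_cat; apply/orP; right; apply/orP; right; apply/orP; right.
    by rewrite addrC; apply: allpairs_f; apply: his.
  by rewrite addrC subr_eq0 eq_sym => /(_ xi) /negPf ->; rewrite mulr0.
- move=> cn0; rewrite segnW //; last by move: Zm; case: (ph _) => [[] []].
  apply/eqP => e; have := LD c; rewrite inE eqxx => /(_ isT cn0).
  by rewrite -zerow_addw e zzs.
Qed.

Lemma W3_act_inj u : W3_act u =1 id -> u = W3_one.
Proof.
case: u => f g phi1.
(* The Z-translation leaves the test of the top generator unchanged, so if g <> 1 this test would be
   both 1 and 0 at a word separating g. *)
have g1 : g = W2_one.
  apply/eqP/negPn/negP => ng.
  have [|w [j [_ w1 wg _]]] := @separating_word [:: g] 0.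
    by rewrite inE eq_sym.
  have := chi_a_mask
    (wr_coef W2_inv (chi (Some true)) W2_act f (W2_act g w))
    (W2_act g w) j.
  rewrite -[addsegs _ _]/(W3_act (f, g) w) phi1 w1 wg //.
  by rewrite inE.
rewrite {g}g1 in phi1 *; congr pair; apply/fsfunP => k0; rewrite wbase0E.
apply/eqP/negPn/negP => fk0.
(* At the point [W2_act k0 w] the term of k tests k^-1 k0 w, which vanishes unless k = k0. Segment j
   is thus moved by exactly [f k0]. *)
have [|w [j [Zj w1 wg /(_ fk0) wc]]] :=
  @separating_word [seq W2_mul (W2_inv k) k0 | k <- finsupp f & k != k0] (f k0).
  apply/mapP => -[k]; rewrite mem_filter => /andP[kk0 _] e.
  move/eqP: kk0; apply; rewrite -(gl_mulVKl W2_group_laws k k0) -e.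
  by rewrite (gl1r W2_group_laws).
move/eqP: wc; apply.
rewrite -(seg_W2_act_Z k0 w Zj) -[in RHS](phi1 (W2_act k0 w)).
rewrite /W3_act /wr_act /= W2_act_1 /addZ seg_addsegs /on_phase.
rewrite Zj; congr addw.
rewrite /wr_coef (big_fsetD1 k0) ?mem_finsupp //= -W2_act_mul.
rewrite (glVl W2_group_laws) W2_act_1 w1 mulr1 big1_fset ?addr0 // => k.
rewrite in_fsetD1 => /andP[kk0 kf] _; rewrite -W2_act_mul wg ?mulr0 //.
by apply: map_f; rewrite mem_filter kk0.
Qed.

End Faithfulness.

Theorem theoremD :
  exists phi : W3 -> (word -> word),
    (* phi is an injective group homomorphism of W_3(Z) into F_2 *)
    (forall u, in_F2 (phi u)) /\
    (forall u v, phi (W3_mul u v) =1 phi u \o phi v) /\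
    (forall u, phi u =1 id -> u = W3_one) /\
    (* consequently its image lies in an automata group on the binary tree *)
    (exists G : (word -> word) -> Prop,
        automata_group G /\ forall u, G (phi u)).
Proof.
exists W3_act; split; first by move=> u; apply/mealy_group_F2/autG_W3_act.
split; first by move=> u v w; apply: W3_act_mul.
split; first exact: W3_act_inj.
exists autG; split; [exact: mealy_group_automata_group | exact: autG_W3_act].
Qed.
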